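(* Let $(\Delta_K,\Delta_G,\Delta_H)$ be a Zappa–Szép Garside structure for the Zappa–Szép product $K=G\bowtie H$, and let $g_1,g_2\in\mathcal D_G$ and $h_1,h_2\in\mathcal D_H$. Then the following hold: (i) $\partial_K(g_1h_1)\wedge(g_2h_2)=\mathbf 1$ if and only if $\partial_G(g_1\blacktriangleleft h_1)\wedge g_2=\mathbf 1$ and $\partial_Hh_1\wedge(g_2\blacktriangleright h_2)=\mathbf 1$; (ii) $\partial_K(g_1h_1)\wedge(h_2g_2)=\mathbf 1$ if and only if $\partial_G(g_1\blacktriangleleft h_1)\wedge(h_2\triangleright g_2)=\mathbf 1$ and $\partial_Hh_1\wedge h_2=\mathbf 1$; (iii) $\partial_K(h_1g_1)\wedge(g_2h_2)=\mathbf 1$ if and only if $\partial_Gg_1\wedge g_2=\mathbf 1$ and $\partial_H(h_1\triangleleft g_1)\wedge(g_2\blacktriangleright h_2)=\mathbf 1$; (iv) $\partial_K(h_1g_1)\wedge(h_2g_2)=\mathbf 1$ if and only if $\partial_Gg_1\wedge(h_2\triangleright g_2)=\mathbf 1$ and $\partial_H(h_1\triangleleft g_1)\wedge h_2=\mathbf 1$. If, moreover, $g_2\neq\mathbf 1$ and $h_2\neq\mathbf 1$, then: (v) $g_1h_1\,|\,g_2h_2$ if and only if $(g_1\blacktriangleleft h_1)\,|\,g_2$ and $h_1\,|\,(g_2\blacktriangleright h_2)$; (vi) $g_1h_1\,|\,h_2g_2$ if and only if $(g_1\blacktriangleleft h_1)\,|\,(h_2\triangleright g_2)$ and $h_1\,|\,h_2$;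 (vii) $h_1g_1\,|\,g_2h_2$ if and only if $g_1\,|\,g_2$ and $(h_1\triangleleft g_1)\,|\,(g_2\blacktriangleright h_2)$; (viii) $h_1g_1\,|\,h_2g_2$ if and only if $g_1\,|\,(h_2\triangleright g_2)$ and $(h_1\triangleleft g_1)\,|\,h_2$.
   Context: Zappa–Szép product: for a monoid $K$ with submonoids $G,H$, write $K=G\bowtie H$ if for every $k\in K$ there exist unique $g_1,g_2\in G$ and $h_1,h_2\in H$ such that $g_1h_1=k=h_2g_2$. Actions: for $g\in G$, $h\in H$ the elements $h\triangleright g\in G$, $h\triangleleft g\in H$, $g\blacktriangleright h\in H$, $g\blacktriangleleft h\in G$ are defined by $hg=(h\triangleright g)(h\triangleleft g)$ and $gh=(g\blacktriangleright h)(g\blacktriangleleft h)$. Garside monoids: in a monoid $M$ with identity $\mathbf 1$, write $x\preccurlyeq y$ ($x$ is a prefix of $y$) if $y=xu$ for some $u\in M$, and $y\succcurlyeq x$ ($x$ is a suffix of $y$) if $y=ux$ for some $u\in M$. An atom is an element $a\neq\mathbf 1$ such that $a=uv$ implies $u=\mathbf 1$ or $v=\mathbf 1$. $M$ is atomic if it is generated by its atoms and for each $x\in M$ there is an upper bound on the lengths of decompositions of $x$ as a product of atoms. An element is balanced if its set of prefixes equals its set of suffixes; this common set is denoted $\mathrm{Div}(d)$. A Garside structure is a pair $(M,\Delta)$ where $M$ is a cancellative atomic monoid, the prefix and suffix relations are lattice orders, $\Delta\in M$ is balanced, $M$ is generated by $\mathrm{Div}(\Delta)$, and $\mathrm{Div}(\Delta)$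 is finite. $M$ is a Garside monoid if such a $\Delta$ (a Garside element) exists. Zappa–Szép Garside structure: $(\Delta_K,\Delta_G,\Delta_H)$ is one for $K=G\bowtie H$ if $K$ is a Garside monoid (it then follows that $G$ and $H$ are Garside monoids), $\Delta_K,\Delta_G,\Delta_H$ are Garside elements of $K,G,H$ respectively, and $\Delta_K=\Delta_G\Delta_H$. Notation: for $M\in\{K,G,H\}$, $\mathcal D_M=\mathrm{Div}(\Delta_M)$, and for $x\in\mathcal D_M$, $\partial_Mx\in\mathcal D_M$ is the unique element with $x\,\partial_Mx=\Delta_M$. $\wedge$ is the meet for the prefix order. For $s_1,s_2\in\mathcal D_M$, $s_1|s_2$ (the word $s_1.s_2$ is in left normal form in $M$) means $s_1,s_2\ne\mathbf 1$ and $\partial_Ms_1\wedge s_2=\mathbf 1$. For $g\in\mathcal D_G$ and $h\in\mathcal D_H$ the products $gh$ and $hg$ lie in $\mathcal D_K$, the elements $h\triangleright g$ and $g\blacktriangleleft h$ lie in $\mathcal D_G$, and $h\triangleleft g$ and $g\blacktriangleright h$ lie in $\mathcal D_H$. *)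

(* Defs.v *)
From HB Require Import structures.
From mathcomp Require Import all_boot.
From mathcomp Require Import boolp classical_sets functions cardinality.

Set Implicit Arguments.
Unset Strict Implicit.
Unset Printing Implicit Defensive.

Local Open Scope classical_set_scope.
Local Open Scope group_scope.

Section Order.
Context {T : Type}.
Implicit Types (A : set T) (R : T -> T -> Prop).

Definition is_meet A R (x y z : T) : Prop :=
  [/\ A z, R z x, R z y & forall w, A w -> R w x -> R w y -> R w z].

Definition is_join A R (x y z : T) : Prop :=
  [/\ A z, R x z, R y z & forall w, A w -> R x w -> R y w -> R z w].

Definition lattice_order A R : Prop :=
  [/\ forall x, A x -> R x x,
      forall x y, A x -> A y -> R x y -> R y x -> x = y,
      forall x y z, A x -> A y -> A z -> R x y -> R y z -> R x z,
      forall x y, A x -> A y -> exists z, is_meet A R x y z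
    & forall x y, A x -> A y -> exists z, is_join A R x y z].

End Order.

(* Submonoids of K are sets M : set K satisfying [monoid_closed [in M]]. All
   notions below are intrinsic to the monoid M: quotients, decompositions,
   bounds, etc. are taken inside M. The monoid K itself is M = [set: K]. *)
Section Garside.
Context {K : monoidType}.
Implicit Types (M : set K) (x y a d : K).

Definition prefix_in M x y : Prop := exists2 u, M u & y = x * u.

Definition suffix_in M x y : Prop := exists2 u, M u & y = u * x.

Definition prefixes M d : set K := [set x | M x /\ prefix_in M x d].

Definition suffixes M d : set K := [set x | M x /\ suffix_in M x d].

Definition atom M a : Prop :=
  [/\ M a, a <> 1 &
      forall u v, M u -> M v -> a = u * v -> u = 1 \/ v = 1].

Definition generated_by M (S : set K) : Prop :=
  forall x, M x ->
    exists2 s : seq K, (forall a, a \in s -> S a) & x = \prod_(a <- s) a.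

Definition atomic M : Prop :=
  generated_by M (atom M) /\
  forall x, M x -> exists n : nat, forall s : seq K,
    (forall a, a \in s -> atom M a) -> x = \prod_(a <- s) a -> (size s <= n)%N.

Definition cancellative M : Prop :=
  forall x y z, M x -> M y -> M z ->
    (x * y = x * z -> y = z) /\ (y * x = z * x -> y = z).

Definition balanced M d : Prop := M d /\ prefixes M d = suffixes M d.

(* Only meaningful when d is balanced in M. *)
Definition Div M d : set K := prefixes M d.

Definition garside_structure M d : Prop :=
  [/\ monoid_closed [in M], cancellative M & atomic M] /\
  [/\ lattice_order M (prefix_in M), lattice_order M (suffix_in M),
      balanced M d, generated_by M (Div M d) & finite_set (Div M d)].

Definition garside_monoid M : Prop := exists d, garside_structure M d.

(* The next two functions return the junk value 1 when the element sought does
   not exist; this cannot happen in a Garside structure (M, d), for x in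
   Div M d in the case of [compl]. *)
Definition compl M d x : K := xget 1 [set u | Div M d u /\ x * u = d].

Definition meet M x y : K := xget 1 (is_meet M (prefix_in M) x y).

Definition left_normal M d x y : Prop :=
  [/\ x <> 1, y <> 1 & meet M (compl M d x) y = 1].

End Garside.

Section ZappaSzep.
Context {K : monoidType}.
Implicit Types (G H : set K) (g h k : K).

Definition factors G H k (p : K * K) : Prop :=
  [/\ G p.1, H p.2 & k = p.1 * p.2].

Definition zappa_szep G H : Prop :=
  [/\ monoid_closed [in G], monoid_closed [in H] &
      forall k, (exists! p, factors G H k p) /\ (exists! p, factors H G k p)].

(* Junk value (1, 1) when k has no factorization, which is excluded when
   [zappa_szep G H] holds. *)
Definition factor G H k : K * K := xget (1, 1) (factors G H k).

Definition hg_to_G G H h g : K := (factor G H (h * g)).1.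
Definition hg_to_H G H h g : K := (factor G H (h * g)).2.
Definition gh_to_H G H g h : K := (factor H G (g * h)).1.
Definition gh_to_G G H g h : K := (factor H G (g * h)).2.

Definition zappa_szep_garside G H (dK dG dH : K) : Prop :=
  [/\ zappa_szep G H, garside_monoid [set: K]
    & [/\ garside_structure [set: K] dK, garside_structure G dG,
          garside_structure H dH & dK = dG * dH]].

End ZappaSzep.

Notation "h ▷[ G , H ] g" := (hg_to_G G H h g)
  (at level 39, no associativity, format "h  ▷[ G ,  H ]  g").
Notation "h ◁[ G , H ] g" := (hg_to_H G H h g)
  (at level 39, no associativity, format "h  ◁[ G ,  H ]  g").
Notation "g ▶[ G , H ] h" := (gh_to_H G H g h)
  (at level 39, no associativity, format "g  ▶[ G ,  H ]  h").
Notation "g ◀[ G , H ] h" := (gh_to_G G H g h)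
  (at level 39, no associativity, format "g  ◀[ G ,  H ]  h").

(* Main.v *)
(* A nontrivial common prefix of two elements of K, written gh, yields one in G
   (if g <> 1) or one in H (if g = 1). The prefixes lying in G of an element gh
   are the prefixes of g, and gh divides Delta_K exactly when g and h divide
   Delta_G and Delta_H; so coprimality in K splits into coprimality in G and
   in H. Since also Delta_K = Delta_H Delta_G, the roles of G and H are
   interchangeable, and (ii) and (vi) imply all the other equivalences. *)

Require Import Defs.
From mathcomp Require Import all_boot.
From mathcomp Require Import boolp classical_sets functions cardinality.

Local Open Scope classical_set_scope.
Local Open Scope group_scope.

(** * Divisors of a Garside element, and coprimality with a complement *)

Section GarsideTheory.
Context {K : monoidType} {M : set K} {d : K} (gM : garside_structure M d).
Implicit Types x y z w : K.

Lemma garside_mem1 : M 1.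
Proof. by case: gM => -[[/asboolP]]. Qed.

Lemma garside_memM x y : M x -> M y -> M (x * y).
Proof.
by case: gM => -[[_ clM] _ _] _ /asboolP Mx /asboolP My; apply/asboolP/clM.
Qed.

Lemma garside_mulgI x y z : M x -> M y -> M z -> x * y = x * z -> y = z.
Proof. by case: gM => -[_ can _] _ Mx My Mz; case: (can x y z Mx My Mz). Qed.

Lemma garside_mulIg x y z : M x -> M y -> M z -> y * x = z * x -> y = z.
Proof. by case: gM => -[_ can _] _ Mx My Mz; case: (can x y z Mx My Mz). Qed.

Lemma prefix_in_anti x y :
  M x -> M y -> prefix_in M x y -> prefix_in M y x -> x = y.
Proof. by case: gM => _ [[_ anti _ _ _] _ _ _ _]; exact: anti. Qed.

Lemma garside_unit x y : M x -> M y -> x * y = 1 -> x = 1.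
Proof.
move=> Mx My xy1; apply: prefix_in_anti => //; first exact: garside_mem1.
  by exists y.
by exists x => //; rewrite mul1g.
Qed.

Lemma mem_Div x : Div M d x -> M x.
Proof. by case. Qed.

Lemma Div_top : Div M d d.
Proof.
have [_ [_ _ [Md _] _ _]] := gM; split=> //.
by exists 1; [exact: garside_mem1 | rewrite mulg1].
Qed.

Lemma Div_suffix x : Div M d x <-> M x /\ suffix_in M x d.
Proof. by case: gM => _ [_ _ [_ bal] _ _]; rewrite /Div bal. Qed.

(** A prefix [x * y] of [d] is also a suffix since [d] is balanced, and then so is [y]. *)
Lemma Div_factor x y z : M x -> M y -> M z -> Div M d (x * y * z) -> Div M d y.
Proof.
move=> Mx My Mz [_ [u Mu dE]].
have Myzu : M (y * (z * u)) by do !apply: garside_memM.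
have /Div_suffix [_ [v Mv dE']] : Div M d (x * y).
  split; first exact: garside_memM.
  by exists (z * u); [exact: garside_memM | rewrite mulgA].
apply/Div_suffix; split=> //.
by exists (v * x); [exact: garside_memM | rewrite dE' mulgA].
Qed.

Lemma Div_left x y : M x -> M y -> Div M d (x * y) -> Div M d x.
Proof.
move=> Mx My Dxy; apply: (@Div_factor 1 x y) => //; first exact: garside_mem1.
by rewrite mul1g.
Qed.

Lemma Div_right x y : M x -> M y -> Div M d (x * y) -> Div M d y.
Proof.
move=> Mx My Dxy; apply: (@Div_factor x y 1) => //; first exact: garside_mem1.
by rewrite mulg1.
Qed.

Lemma complP x : Div M d x -> Div M d (compl M d x) /\ x * compl M d x = d.
Proof.
case=> Mx [u Mu dE].
suff: [set v | Div M d v /\ x * v = d] (compl M d x) by [].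
apply: xgetPex; exists u; split=> //; apply: (Div_right x) => //.
by rewrite -dE; exact: Div_top.
Qed.

(** Cancelling [x] in [x * compl M d x = d] trades the complement for divisibility of [d], the form
    in which coprimality is handled below. *)
Lemma prefix_compl x w :
  Div M d x -> M w -> prefix_in M w (compl M d x) <-> Div M d (x * w).
Proof.
move=> Dx Mw; have [[Mc _] xc] := complP _ Dx; have Mx := mem_Div _ Dx.
split=> [[u Mu cE]|[_ [u Mu dE]]].
  by split; [exact: garside_memM | exists u; rewrite // -mulgA -cE xc].
exists u => //; apply: (garside_mulgI x) => //; first exact: garside_memM.
by rewrite xc mulgA.
Qed.

Lemma meet_eq1 x y : M x -> M y -> meet M x y = 1 <->
  forall w, M w -> prefix_in M w x -> prefix_in M w y -> w = 1.
Proof.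
move=> Mx My.
have [Mm mx my m_max] : is_meet M (prefix_in M) x y (meet M x y).
  apply: xgetPex.
  by case: gM => _ [[_ _ _ ex_meet _] _ _ _ _]; exact: ex_meet.
split=> [m1 w Mw wx wy|]; last exact.
have [u Mu wu] := m_max w Mw wx wy.
by apply: (garside_unit w u) => //; rewrite -wu.
Qed.

Lemma meet_compl_eq1 x y : Div M d x -> M y -> meet M (compl M d x) y = 1 <->
  forall w, M w -> Div M d (x * w) -> prefix_in M w y -> w = 1.
Proof.
move=> Dx My; have [[Mc _] _] := complP _ Dx; rewrite meet_eq1 //.
by split=> cop w Mw; have := cop w Mw; rewrite prefix_compl.
Qed.

(** The complement of [1] is [d], which has [y] as a prefix. This is how coprimality rules out a
    trivial first letter. *)
Lemma meet_compl1_eq1 y : Div M d y -> meet M (compl M d 1) y = 1 -> y = 1.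
Proof.
move=> Dy; have My := mem_Div _ Dy; have M1 := garside_mem1.
have D1 : Div M d 1 by apply: (Div_left _ y) => //; rewrite mul1g.
move/meet_compl_eq1; apply=> //; first by rewrite mul1g.
by exists 1; rewrite ?mulg1.
Qed.

End GarsideTheory.

(** * Unique factorization in a Zappa-Szép product *)

Section ZappaSzepTheory.
Context {K : monoidType} {G H : set K} (zGH : zappa_szep G H).
Implicit Types g h : K.

Lemma zappa_szepC : zappa_szep H G.
Proof. by case: zGH => clG clH ex; split=> // k; case: (ex k). Qed.

Lemma zappa_szep_mem1 : G 1 /\ H 1.
Proof.
by case: zGH => -[/asboolP G1 _] [/asboolP H1 _] _.
Qed.

Lemma factor_ex k : exists g h, [/\ G g, H h & k = g * h].
Proof.
by case: zGH => _ _ /(_ k) [[[g h] [[/= Gg Hh kE] _]] _]; exists g, h.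
Qed.

Lemma factor_inj g h g' h' :
  G g -> H h -> G g' -> H h' -> g * h = g' * h' -> g = g' /\ h = h'.
Proof.
move=> Gg Hh Gg' Hh' E; case: zGH => _ _ /(_ (g * h)) [[p [_ uniq_p]] _].
have /uniq_p pE : factors G H (g * h) (g, h) by [].
have /uniq_p : factors G H (g * h) (g', h') by [].
by rewrite pE => -[].
Qed.

Lemma factor_mul g h : G g -> H h -> factor G H (g * h) = (g, h).
Proof.
move=> Gg Hh; apply: xget_unique => // -[g' h'] [/= Gg' Hh' E].
by have [-> ->] := factor_inj g h g' h' Gg Hh Gg' Hh' E.
Qed.

End ZappaSzepTheory.

(** * Divisors of [dK] against those of [dG] and [dH] *)

Section ZappaSzepGarsideTheory.
Context {K : monoidType} {G H : set K} {dK dG dH : K}.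
Context (zs : zappa_szep_garside G H dK dG dH).
Implicit Types g h k : K.

Let zGH : zappa_szep G H. Proof. by case: zs. Qed.
Let gK : garside_structure [set: K] dK. Proof. by case: zs => _ _ []. Qed.
Let gG : garside_structure G dG. Proof. by case: zs => _ _ []. Qed.
Let gH : garside_structure H dH. Proof. by case: zs => _ _ []. Qed.
Let dKE : dK = dG * dH. Proof. by case: zs => _ _ []. Qed.

(** Factoring the cofactor as [gu * hu] gives [g' * h = (g * gu) * hu], and uniqueness identifies
    the [G]-parts. *)
Lemma prefix_mulGH g g' h :
  G g -> G g' -> H h -> prefix_in [set: K] g (g' * h) -> prefix_in G g g'.
Proof.
move=> Gg Gg' Hh [u _ E]; have [gu [hu [Ggu Hhu uE]]] := factor_ex zGH u.
exists gu => //; rewrite uE mulgA in E.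
by have [] := factor_inj zGH _ _ _ _ Gg' Hh (garside_memM gG _ _ Gg Ggu) Hhu E.
Qed.

Lemma suffix_mulGH g h h' :
  G g -> H h -> H h' -> suffix_in [set: K] h (g * h') -> suffix_in H h h'.
Proof.
move=> Gg Hh Hh' [u _ E]; have [gu [hu [Ggu Hhu uE]]] := factor_ex zGH u.
exists hu => //; rewrite uE -mulgA in E.
by have [] := factor_inj zGH _ _ _ _ Gg Hh' Ggu (garside_memM gH _ _ Hhu Hh) E.
Qed.

(** [g] is a suffix of [dG] and [h] a prefix of [dH], so [g * h] sits in the middle of [dG * dH]. *)
Lemma Div_mulGH g h :
  Div G dG g -> Div H dH h -> Div [set: K] dK (g * h).
Proof.
move=> /(Div_suffix gG) [_ [v _ dGE]] [_ [w _ dHE]].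
apply: (Div_factor gK v _ w) => //.
have -> : v * (g * h) * w = dK by rewrite dKE dGE dHE !mulgA.
exact: Div_top gK.
Qed.

Lemma Div_restrictG g : G g -> Div [set: K] dK g -> Div G dG g.
Proof.
move=> Gg [_]; rewrite dKE; split=> //.
by apply: (prefix_mulGH _ _ dH) => //; [case: (Div_top gG)|case: (Div_top gH)].
Qed.

Lemma Div_restrictH h : H h -> Div [set: K] dK h -> Div H dH h.
Proof.
move=> Hh /(Div_suffix gK) [_]; rewrite dKE => hd; apply/(Div_suffix gH).
split=> //; apply: (suffix_mulGH dG) => //.
  by case: (Div_top gG).
by case: (Div_top gH).
Qed.

Lemma Div_extendG g : Div G dG g -> Div [set: K] dK g.
Proof.
move=> Dg; have [_ H1] := zappa_szep_mem1 zGH.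
rewrite -[g]mulg1; apply: Div_mulGH => //.
by apply: (Div_left gH 1 dH); rewrite ?mul1g //; case: (Div_top gH).
Qed.

Lemma Div_extendH h : Div H dH h -> Div [set: K] dK h.
Proof.
move=> Dh; have [G1 _] := zappa_szep_mem1 zGH.
rewrite -[h]mul1g; apply: Div_mulGH => //.
by apply: (Div_left gG 1 dG); rewrite ?mul1g //; case: (Div_top gG).
Qed.

(** Restores the symmetry between [G] and [H]. As [dH] divides [dK], one has [dK = dH * h * g]; then
    [h = 1], and [g = dG] because each is a suffix of the other. *)
Lemma garside_element_mulHG : dK = dH * dG.
Proof.
have zHG := zappa_szepC zGH.
have [[GdG _] [HdH _]] := (Div_top gG, Div_top gH).
have [_ [k _ dKE']] := Div_extendH _ (Div_top gH).
have [h [g [Hh Gg kE]]] := factor_ex zHG k.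
have dK_hg : dK = dH * h * g by rewrite dKE' kE mulgA.
have Hdh : H (dH * h) by exact: (garside_memM gH).
(* [dH * h] lies in [H] and divides [dK], so it is a prefix of [dH]; cancelling [dH] gives
   [h * w = 1]. *)
have h1 : h = 1.
  have /(Div_restrictH _ Hdh) [_ [w Hw dHE]] : Div [set: K] dK (dH * h).
    by apply: (Div_left gK _ g) => //; rewrite -dK_hg; exact: (Div_top gK).
  apply: (garside_unit gH h w) => //; apply: (garside_mulgI gH dH) => //.
  - exact: (garside_memM gH).
  - exact: (garside_mem1 gH).
  - by rewrite mulg1 mulgA.
rewrite {}h1 mulg1 in dK_hg.
have /(Div_restrictG _ Gg)/(Div_suffix gG) [_ [v Gv dGE]] : Div [set: K] dK g.
  by apply: (Div_right gK dH) => //; rewrite -dK_hg; exact: (Div_top gK).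
(* Conversely, [dG] is a suffix of [dK], hence of its [G]-part [g] by uniqueness; the two cofactors
   satisfy [v * g' = 1]. *)
have /(Div_suffix gK) [_ [k' _ dKE'']] := Div_extendG _ (Div_top gG).
have [h' [g' [Hh' Gg' k'E]]] := factor_ex zHG k'.
have [_ gE] : dH = h' /\ g = g' * dG.
  apply: (factor_inj zHG) => //; first exact: (garside_memM gG).
  by rewrite -dK_hg dKE'' k'E mulgA.
rewrite dK_hg {1}dGE (_ : v = 1) ?mul1g //.
apply: (garside_unit gG v g') => //; apply: (garside_mulIg gG dG) => //.
- exact: (garside_memM gG).
- exact: (garside_mem1 gG).
- by rewrite mul1g -mulgA -gE.
Qed.

End ZappaSzepGarsideTheory.

Lemma zappa_szep_garsideC {K : monoidType} {G H : set K} {dK dG dH : K} :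
  zappa_szep_garside G H dK dG dH -> zappa_szep_garside H G dK dH dG.
Proof.
move=> zs; have dKE := garside_element_mulHG zs.
by case: zs => /zappa_szepC zHG garK [gK gG gH _].
Qed.

(** * Switching between the two factorizations of a product *)

Section Refactor.
Context {K : monoidType} {G H : set K} {dK dG dH : K}.
Context (zs : zappa_szep_garside G H dK dG dH).
Implicit Types g h : K.

Let zGH : zappa_szep G H. Proof. by case: zs. Qed.
Let zHG : zappa_szep H G. Proof. exact: zappa_szepC. Qed.
Let gK : garside_structure [set: K] dK. Proof. by case: zs => _ _ []. Qed.

(** [h'] is a prefix and [g'] a suffix of [g * h], so both divide [dK]. *)
Lemma Div_refactor g h : Div G dG g -> Div H dH h ->
  exists h' g', [/\ Div H dH h', Div G dG g' & g * h = h' * g'].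
Proof.
move=> Dg Dh; have [h' [g' [Hh' Gg' E]]] := factor_ex zHG (g * h).
have DK : Div [set: K] dK (h' * g') by rewrite -E; exact: (Div_mulGH zs).
exists h', g'; split=> //.
  by apply: (Div_restrictH zs) => //; exact: (Div_left gK _ g').
by apply: (Div_restrictG zs) => //; exact: (Div_right gK h').
Qed.

(** A trivial factor puts the product in [G] or [H], where uniqueness applies against a
    factorization with [1]. *)
Lemma factor_eq1 g h h' g' : G g -> H h -> H h' -> G g' ->
  g * h = h' * g' -> (g = 1 <-> g' = 1) /\ (h = 1 <-> h' = 1).
Proof.
move=> Gg Hh Hh' Gg' E; have [G1 H1] := zappa_szep_mem1 zGH.
split; split=> x1; rewrite {}x1 ?mulg1 ?mul1g in E.
- have [] // := factor_inj zHG h 1 h' g'; rewrite ?mulg1 //.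
- have [] // := factor_inj zGH g h 1 h'; rewrite ?mul1g //.
- have [] // := factor_inj zHG 1 g h' g'; rewrite ?mul1g //.
- have [] // := factor_inj zGH g h g' 1; rewrite ?mulg1 //.
Qed.

End Refactor.

(** * Equivalences (ii) and (vi) *)

Section NormalForm.
Context {K : monoidType} {G H : set K} {dK dG dH : K}.
Context (zs : zappa_szep_garside G H dK dG dH).
Context (g1 g2 h1 h2 : K).
Context (Dg1 : Div G dG g1) (Dg2 : Div G dG g2).
Context (Dh1 : Div H dH h1) (Dh2 : Div H dH h2).

Let sz := zappa_szep_garsideC zs.
Let zGH : zappa_szep G H. Proof. by case: zs. Qed.
Let zHG : zappa_szep H G. Proof. exact: zappa_szepC. Qed.
Let gK : garside_structure [set: K] dK. Proof. by case: zs => _ _ []. Qed.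
Let gG : garside_structure G dG. Proof. by case: zs => _ _ []. Qed.
Let gH : garside_structure H dH. Proof. by case: zs => _ _ []. Qed.

(** With [g1 * h1 = h1' * g1'] and [h2 * g2 = g2' * h2'], the end of the first product and the start
    of the second can be read in either submonoid: [g1'] faces [g2'], and [h1] faces [h2]. *)
Lemma meet_compl_GH_HG :
  meet [set: K] (compl [set: K] dK (g1 * h1)) (h2 * g2) = 1 <->
  meet G (compl G dG (g1 ◀[G, H] h1)) (h2 ▷[G, H] g2) = 1 /\
  meet H (compl H dH h1) h2 = 1.
Proof.
have [h1' [g1' [Dh1' Dg1' E1]]] := Div_refactor zs _ _ Dg1 Dh1.
have [g2' [h2' [Dg2' Dh2' E2]]] := Div_refactor sz _ _ Dh2 Dg2.
have Gg1 := mem_Div _ Dg1; have Gg2 := mem_Div _ Dg2.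
have Hh1 := mem_Div _ Dh1; have Hh2 := mem_Div _ Dh2.
have Gg1' := mem_Div _ Dg1'; have Gg2' := mem_Div _ Dg2'.
have Hh1' := mem_Div _ Dh1'; have Hh2' := mem_Div _ Dh2'.
rewrite /gh_to_G /hg_to_G E1 E2 (factor_mul zHG) // (factor_mul zGH) //= -E1 -E2.
have DK : Div [set: K] dK (g1 * h1) := Div_mulGH zs _ _ Dg1 Dh1.
rewrite (meet_compl_eq1 gK) // (meet_compl_eq1 gG) // (meet_compl_eq1 gH) //.
split=> [cop|[copG copH] w _].
  split=> w Mw Dw [u Mu wu]; apply: cop => //.
  - by rewrite E1 -mulgA; exact: (Div_mulGH sz).
  - by exists (u * h2'); rewrite // E2 wu mulgA.
  - by rewrite -mulgA; exact: (Div_mulGH zs).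
  - by exists (u * g2); rewrite // wu mulgA.
have [g [h [Gg Hh ->]]] := factor_ex zGH w => Dgh [u _ Eu].
have Gg1g : G (g1' * g) by exact: (garside_memM gG).
have Hh1h : H (h1 * h) by exact: (garside_memM gH).
(* [g1' * g] is a middle factor of [h1' * g1' * g * h], which divides [dK]. *)
have g_eq1 : g = 1.
  apply: copG => //.
    apply: (Div_restrictG zs) => //.
    by apply: (Div_factor gK h1' _ h) => //; rewrite !mulgA -E1 -mulgA.
  by apply: (prefix_mulGH zs _ _ h2') => //; exists (h * u); rewrite // -E2 Eu mulgA.
(* The common divisor is now [h], in [H], and [h1 * h] is a suffix of [g1 * (h1 * h)]. *)
rewrite {}g_eq1 !mul1g in Dgh Eu *; apply: copH => //.
  by apply: (Div_restrictH zs) => //; apply: (Div_right gK g1); rewrite // mulgA.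
by apply: (prefix_mulGH sz _ _ g2) => //; exists u.
Qed.

Lemma left_normal_GH_HG : g2 <> 1 -> h2 <> 1 ->
  left_normal [set: K] dK (g1 * h1) (h2 * g2) <->
  left_normal G dG (g1 ◀[G, H] h1) (h2 ▷[G, H] g2) /\ left_normal H dH h1 h2.
Proof.
move=> g2n1 h2n1; rewrite /left_normal (propext meet_compl_GH_HG).
have [h1' [g1' [Dh1' Dg1' E1]]] := Div_refactor zs _ _ Dg1 Dh1.
have [g2' [h2' [Dg2' Dh2' E2]]] := Div_refactor sz _ _ Dh2 Dg2.
have Gg1 := mem_Div _ Dg1; have Gg2 := mem_Div _ Dg2.
have Hh1 := mem_Div _ Dh1; have Hh2 := mem_Div _ Dh2.
have Gg1' := mem_Div _ Dg1'; have Gg2' := mem_Div _ Dg2'.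
have Hh1' := mem_Div _ Dh1'; have Hh2' := mem_Div _ Dh2'.
rewrite /gh_to_G /hg_to_G E1 E2 (factor_mul zHG) // (factor_mul zGH) //= -E1 -E2.
have g2'n1 : g2' <> 1.
  by have [_ eq1] := factor_eq1 sz _ _ _ _ Hh2 Gg2 Gg2' Hh2' E2; rewrite -eq1.
split=> [[_ _ [mG mH]]|[[_ _ mG] [h1n1 _ mH]]].
  (* If [g1'] or [h1] were [1], its complement would be [dG] or [dH], and coprimality would force
     [g2' = 1] or [h2 = 1]. *)
  split; split=> // x1.
  - by rewrite x1 in mG; apply: g2'n1; exact: (meet_compl1_eq1 gG).
  - by rewrite x1 in mH; apply: h2n1; exact: (meet_compl1_eq1 gH).
split=> // [gh1|hg1].
  have [G1 H1] := zappa_szep_mem1 zGH; apply: h1n1.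
  by have [] // := factor_inj zGH g1 h1 1 1; rewrite ?mulg1.
by apply: h2n1; apply: (garside_unit gK h2 g2).
Qed.

End NormalForm.

(** * Equivalences (i) and (v) *)

Section NormalFormRefactored.
Context {K : monoidType} {G H : set K} {dK dG dH : K}.
Context (zs : zappa_szep_garside G H dK dG dH).
Context (g1 g2 h1 h2 : K).
Context (Dg1 : Div G dG g1) (Dg2 : Div G dG g2).
Context (Dh1 : Div H dH h1) (Dh2 : Div H dH h2).

Let zGH : zappa_szep G H. Proof. by case: zs. Qed.
Let zHG : zappa_szep H G. Proof. exact: zappa_szepC. Qed.

(* With g2 h2 = h2' g2', this is the previous case for h2' and g2', as
   g2 = h2' ▷ g2'. *)
Lemma meet_compl_GH_GH :
  meet [set: K] (compl [set: K] dK (g1 * h1)) (g2 * h2) = 1 <->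
  meet G (compl G dG (g1 ◀[G, H] h1)) g2 = 1 /\
  meet H (compl H dH h1) (g2 ▶[G, H] h2) = 1.
Proof.
have [h2' [g2' [Dh2' Dg2' E2]]] := Div_refactor zs _ _ Dg2 Dh2.
have := meet_compl_GH_HG zs _ _ _ _ Dg1 Dg2' Dh1 Dh2'.
have [[Gg2 Hh2] [Gg2' Hh2']] :=
  (mem_Div _ Dg2, mem_Div _ Dh2, (mem_Div _ Dg2', mem_Div _ Dh2')).
(* The third [g2 * h2] is the one inside [g2 ▶[G, H] h2]; it alone is turned back into
   [h2' * g2']. *)
rewrite /hg_to_G /gh_to_H -E2 (factor_mul zGH) //= {3}E2.
by rewrite (factor_mul zHG).
Qed.

(** The same reduction, where [factor_eq1] carries the nontriviality of [g2] and [h2] to [g2'] and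
    [h2']. *)
Lemma left_normal_GH_GH : g2 <> 1 -> h2 <> 1 ->
  left_normal [set: K] dK (g1 * h1) (g2 * h2) <->
  left_normal G dG (g1 ◀[G, H] h1) g2 /\
  left_normal H dH h1 (g2 ▶[G, H] h2).
Proof.
have [h2' [g2' [Dh2' Dg2' E2]]] := Div_refactor zs _ _ Dg2 Dh2.
have [[Gg2 Hh2] [Gg2' Hh2']] :=
  (mem_Div _ Dg2, mem_Div _ Dh2, (mem_Div _ Dg2', mem_Div _ Dh2')).
have [-> ->] := factor_eq1 zs _ _ _ _ Gg2 Hh2 Hh2' Gg2' E2 => g2'n1 h2'n1.
have := left_normal_GH_HG zs _ _ _ _ Dg1 Dg2' Dh1 Dh2' g2'n1 h2'n1.
rewrite /hg_to_G /gh_to_H -E2 (factor_mul zGH) //= {3}E2.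
by rewrite (factor_mul zHG).
Qed.

End NormalFormRefactored.

Theorem corollary48 (K : monoidType) (G H : set K) (dK dG dH : K)
    (hZS : zappa_szep_garside G H dK dG dH)
    (g1 g2 h1 h2 : K)
    (hg1 : Div G dG g1) (hg2 : Div G dG g2)
    (hh1 : Div H dH h1) (hh2 : Div H dH h2) :
  [/\ (* i *)
      meet [set: K] (compl [set: K] dK (g1 * h1)) (g2 * h2) = 1 <->
      meet G (compl G dG (g1 ◀[G, H] h1)) g2 = 1 /\
      meet H (compl H dH h1) (g2 ▶[G, H] h2) = 1,
      (* ii *)
      meet [set: K] (compl [set: K] dK (g1 * h1)) (h2 * g2) = 1 <->
      meet G (compl G dG (g1 ◀[G, H] h1)) (h2 ▷[G, H] g2) = 1 /\
      meet H (compl H dH h1) h2 = 1,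
      (* iii *)
      meet [set: K] (compl [set: K] dK (h1 * g1)) (g2 * h2) = 1 <->
      meet G (compl G dG g1) g2 = 1 /\
      meet H (compl H dH (h1 ◁[G, H] g1)) (g2 ▶[G, H] h2) = 1
    & (* iv *)
      meet [set: K] (compl [set: K] dK (h1 * g1)) (h2 * g2) = 1 <->
      meet G (compl G dG g1) (h2 ▷[G, H] g2) = 1 /\
      meet H (compl H dH (h1 ◁[G, H] g1)) h2 = 1] /\
  (g2 <> 1 -> h2 <> 1 ->
  [/\ (* v *)
      left_normal [set: K] dK (g1 * h1) (g2 * h2) <->
      left_normal G dG (g1 ◀[G, H] h1) g2 /\
      left_normal H dH h1 (g2 ▶[G, H] h2),
      (* vi *)
      left_normal [set: K] dK (g1 * h1) (h2 * g2) <->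
      left_normal G dG (g1 ◀[G, H] h1) (h2 ▷[G, H] g2) /\
      left_normal H dH h1 h2,
      (* vii *)
      left_normal [set: K] dK (h1 * g1) (g2 * h2) <->
      left_normal G dG g1 g2 /\
      left_normal H dH (h1 ◁[G, H] g1) (g2 ▶[G, H] h2)
    & (* viii *)
      left_normal [set: K] dK (h1 * g1) (h2 * g2) <->
      left_normal G dG g1 (h2 ▷[G, H] g2) /\
      left_normal H dH (h1 ◁[G, H] g1) h2]).
Proof.
(* Exchanging G and H exchanges ▷ with ▶ and ◁ with ◀ (by conversion). *)
have sz := zappa_szep_garsideC hZS.
split=> [|g2n1 h2n1]; split.
- exact: (meet_compl_GH_GH hZS).
- exact: (meet_compl_GH_HG hZS).
- by rewrite andC; exact: (meet_compl_GH_HG sz).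
- by rewrite andC; exact: (meet_compl_GH_GH sz).
- exact: (left_normal_GH_GH hZS).
- exact: (left_normal_GH_HG hZS).
- by rewrite andC; exact: (left_normal_GH_HG sz).
- by rewrite andC; exact: (left_normal_GH_GH sz).
Qed.
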